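(* Let $\alpha\in(0,1)$ and let $\phi\ne0$ be an integer chosen in advance. Consider the following sequential test for $\mathcal D_{\mathbb Z}=\bigcup_{\theta\in\mathbb Z}\mathcal D_\theta$ based on i.i.d. integer-valued observations $X_1,X_2,\dots$: reject the null hypothesis upon the first $n\ge2$ such that $$J_{2:n}\big(\mathrm{CI}(X_1;\alpha/3,\phi)\cap\mathrm{CI}(X_1;\alpha/3,-\phi)\big)\ge3/\alpha.$$ Then this is a sequential test with uniform type-I error control below $\alpha$ and with power 1: for every $P\in\mathcal D_{\mathbb Z}$, if $X_1,X_2,\dots$ are i.i.d. with distribution $P$, the probability that the test rejects after finitely many observations is at most $\alpha$; and for every $Q\in\mathcal P(\mathbb Z)\setminus\mathcal D_{\mathbb Z}$, if $X_1,X_2,\dots$ are i.i.d. with distribution $Q$, the test rejects after finitely many observations with probability 1.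
   Context: $\mathcal P(\mathbb Z)$ is the set of probability measures on $\mathbb Z$; $f_P(n)=P(\{n\})$; $x^+=\max(x,0)$. For $\theta\in\mathbb Z$, $$\mathcal D_\theta=\{P\in\mathcal P(\mathbb Z): f_P(n-1)\le f_P(n)\text{ if }n\le\theta,\ \text{and } f_P(n)\ge f_P(n+1)\text{ if }n\ge\theta\}.$$ With $T_\alpha=2/\alpha+1$, define for $x,\phi\in\mathbb Z$ $$\mathrm{CI}(x;\alpha,\phi)=\begin{cases}\big(x-T_\alpha|x-\phi|,\ x+T_\alpha|x-\phi|\big)\cap\mathbb Z,&x\ne\phi,\\ \mathbb Z,&x=\phi.\end{cases}$$ For a probability measure $R$ on $\mathbb Z$ and an integer $m\ge0$ define, for $x\in\mathbb Z$, $$E^{R,m}(x)=1+\lambda_{R,m}\big(-\mathbf 1_{\{x=m\}}+\mathbf 1_{\{x=m+1\}}\big),\qquad \lambda_{R,m}=\frac{(f_R(m+1)-f_R(m))^+}{2(f_R(m)+f_R(m+1))},\quad 0/0:=0.$$ For data $Y_1,Y_2,\dots$ and $\theta\in\mathbb Z$, let $\hat Q^{+,\theta}_k$ and $\hat Q^{-,\theta}_k$ be the empirical measures of $Y_1-\theta,\dots,Y_k-\theta$ and of $\theta-Y_1,\dots,\theta-Y_k$ respectively ($k\ge1$), and for $k=0$ interpret $E^{\hat Q^{\pm,\theta}_0,m}\equiv1$. Define $$J_n^{m+}(\theta)=\prod_{k=1}^nE^{\hat Q^{+,\theta}_{k-1},m}(Y_k-\theta),\quad J_n^{m-}(\theta)=\prod_{k=1}^nE^{\hat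 Q^{-,\theta}_{k-1},m}(\theta-Y_k),\quad J_n(\theta)=\sum_{m=0}^\infty2^{-m-2}\big(J_n^{m+}(\theta)+J_n^{m-}(\theta)\big),$$ and $J_n(\Theta)=\min_{\theta\in\Theta}J_n(\theta)$ for finite nonempty $\Theta\subseteq\mathbb Z$. Then $J_{2:n}(\Theta)$ denotes this process run on the observations $(X_2,\dots,X_n)$, i.e. $J_{n-1}(\Theta)$ computed with $Y_i=X_{i+1}$, $i=1,\dots,n-1$. *)

(* Defs.v *)
From HB Require Import structures.
From mathcomp Require Import all_boot all_order all_algebra.
From mathcomp Require Import all_classical all_reals all_analysis.

Set Implicit Arguments.
Unset Strict Implicit.
Unset Printing Implicit Defensive.

Import Order.TTheory GRing.Theory Num.Theory.
Import numFieldNormedType.Exports.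

Local Open Scope classical_set_scope.
Local Open Scope ring_scope.

(* The library makes nat, but not int, a discrete measurable space. *)
HB.instance Definition _ := isPointed.Build int 0.
HB.instance Definition _ := @isMeasurable.Build default_measure_display
  int (@discrete_measurable int) (@discrete_measurable0 int)
  (@discrete_measurableC int) (@discrete_measurableU int).

Section Distributions.
Variable R : realType.

Definition mass (P : set int -> \bar R) (n : int) : R := fine (P [set n]).

Definition unimodal_at (theta : int) : set (probability int R) :=
  [set P | (forall n : int, n <= theta -> mass P (n - 1) <= mass P n) /\
           (forall n : int, theta <= n -> mass P (n + 1) <= mass P n)].

Definition unimodal : set (probability int R) :=
  \bigcup_(theta in [set: int]) unimodal_at theta.

(* The empirical measure of the observations in [s].  For [s = [::]] this is
   the zero measure. *)
Definition empirical (s : seq int) : set int -> \bar R :=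
  mscale ((size s)%:R^-1)%:nng (msum (fun i => \d_(s`_i)) (size s)).

End Distributions.

Section EProcess.
Variable R : realType.

(* Division by 0 returns 0 in a field, so [betting_fraction] is 0 when both
   masses vanish; in particular [evalue (empirical [::]) m] is constantly 1. *)
Definition betting_fraction (P : set int -> \bar R) (m : nat) : R :=
  Num.max (mass P m.+1%:Z - mass P m%:Z) 0 /
  (2 * (mass P m%:Z + mass P m.+1%:Z)).

Definition evalue (P : set int -> \bar R) (m : nat) (x : int) : R :=
  1 + betting_fraction P m * (- (x == m%:Z)%:R + (x == m.+1%:Z)%:R).

(* [J_factor m z] is $J_n^{m+}(\theta)$ for [z] the sequence of the
   $Y_i - \theta$, $i \le n$, and $J_n^{m-}(\theta)$ for [z] the sequence of
   the $\theta - Y_i$.  Indices of sequences start at 0, so that the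
   observation [z`_k] is bet on with the empirical measure of its [k]
   predecessors. *)
Definition J_factor (m : nat) (z : seq int) : R :=
  \prod_(k < size z) evalue (@empirical R (take k z)) m z`_k.

(* Here $n$ is [size y]. *)
Definition J (y : seq int) (theta : int) : \bar R :=
  (\sum_(0 <= m <oo)
     (2 ^- m.+2 * (J_factor m [seq yi - theta | yi <- y] +
                   J_factor m [seq theta - yi | yi <- y]))%:E)%E.

(* For finite nonempty [Theta] the infimum is a minimum, see [J_setP]. *)
Definition J_set (y : seq int) (Theta : set int) : \bar R :=
  ereal_inf [set J y theta | theta in Theta].

Lemma J_setP (y : seq int) (Theta : set int) :
  finite_set Theta -> Theta !=set0 ->
  exists2 theta, Theta theta &
    J_set y Theta = J y theta /\
    forall theta', Theta theta' -> (J y theta <= J y theta')%E.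
Proof.
move=> /finite_seqP[s ->] [t0 /= t0s].
have [t ts tmin] : exists2 t, t \in s & forall t', t' \in s -> (J y t <= J y t')%E.
  elim: s t0 t0s => [//|a s IHs] t0 _.
  have [->|[b bs]] : s = [::] \/ exists b, b \in s.
  - by case: (s) => [|b ?]; [left|right; exists b; rewrite mem_head].
  - by exists a => [|t']; rewrite inE // => /eqP->.
  have [t ts tmin] := IHs b bs.
  have [la|/ltW lt] := leP (J y a) (J y t).
  - exists a; rewrite ?mem_head // => t'; rewrite inE => /orP[/eqP->//|/tmin].
    exact: le_trans.
  - exists t; first by rewrite inE ts orbT.
    by move=> t'; rewrite inE => /orP[/eqP->//|/tmin].
exists t => //; split=> //; apply/eqP; rewrite eq_le; apply/andP; split.
  by apply: ereal_inf_lbound; exists t.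
by apply: le_ereal_inf_tmp => _ [t' /= /tmin ? <-].
Qed.

End EProcess.

Section ConfidenceInterval.
Variable R : realType.

Definition CI (x : int) (alpha : R) (phi : int) : set int :=
  let r := (2 / alpha + 1) * `|x%:~R - phi%:~R| in
  if x == phi then setT
  else [set theta : int | x%:~R - r < theta%:~R < x%:~R + r].

Lemma CI2_nonempty (x : int) (alpha : R) (phi : int) : 0 < alpha ->
  (CI x alpha phi `&` CI x alpha (- phi)) !=set0.
Proof.
move=> a0; suff H psi : CI x alpha psi x by exists x.
rewrite /CI; case: eqVneq => //= xpsi.
have r0 : 0 < (2 / alpha + 1) * `|x%:~R - psi%:~R| :> R.
  by rewrite mulr_gt0 ?addr_gt0 ?divr_gt0 // normr_gt0 subr_eq0 eqr_int.
by rewrite ltrDl r0 ltrBlDr ltrDl r0.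
Qed.

Lemma CI2_finite (x : int) (alpha : R) (phi : int) : phi != 0 ->
  finite_set (CI x alpha phi `&` CI x alpha (- phi)).
Proof.
move=> phi0.
suff H psi : x != psi -> finite_set (CI x alpha psi).
  have [xphi|xphi] := eqVneq x phi; last exact/finite_setIl/H.
  apply/finite_setIr/H; rewrite xphi -subr_eq0 opprK.
  by rewrite -mulr2n mulrn_eq0.
move=> xpsi; rewrite /CI (negPf xpsi).
set r := _ * _; set n := `|Num.floor r|%N.+1.
apply: (@sub_finite_set _ _ [set x - n%:Z + i%:Z | i in `I_(n + n)]); last first.
  exact/finite_image/finite_II.
have rn : r < n%:R.
  apply: (lt_le_trans (floorD1_gt r)).
  by rewrite -[n%:R]/(n%:Z%:~R) ler_int /n -addn1 PoszD lerD2r abszE ler_norm.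
move=> t /= /andP[lt gt].
have {}lt : x - n%:Z < t.
  by rewrite -(ltr_int R) (le_lt_trans _ lt) // intrB lerD2l lerN2 ltW.
have {}gt : t < x + n%:Z.
  by rewrite -(ltr_int R) (lt_trans gt) // intrD ltrD2l.
exists (absz (t - (x - n%:Z))%R); last by rewrite gez0_abs ?subr_ge0 1?ltW // addrC subrK.
rewrite /= -ltz_nat gez0_abs ?subr_ge0 1?ltW // PoszD.
by rewrite ltrBlDr addrACA subrr addr0 addrC.
Qed.

End ConfidenceInterval.

Section SequentialTests.
Variable R : realType.

(* A sequential test decides, after each observation, from the observations
   made so far; [T s] means rejection upon the last observation of [s]. *)
Definition sequential_test := seq int -> Prop.

Definition rejection (T : sequential_test) (Omega : Type)
    (X : nat -> Omega -> int) : set Omega :=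
  [set w | exists n, T (mkseq (X ^~ w) n)].

Lemma measurable_rejection (T : sequential_test) d (Omega : measurableType d)
    (P : probability Omega R) (X : nat -> {RV P >-> int}) :
  measurable (rejection T X).
Proof.
have -> : rejection T X = \bigcup_n \bigcup_(s in [set s : seq int | T s])
    (if size s == n then \bigcap_(i < n) (X i @^-1` [set s`_i])
     else set0).
  rewrite eqEsubset; split=> w.
    move=> [n Tn]; exists n => //; exists (mkseq (X ^~ w) n) => //.
    rewrite size_mkseq eqxx => i /= ni.
    by rewrite nth_mkseq.
  move=> [n _ [s Ts]]; case: eqP => // sn.
  move=> H; exists n.
  rewrite (_ : mkseq _ _ = s) //; apply: (@eq_from_nth _ 0).
    by rewrite size_mkseq.
  by move=> i; rewrite size_mkseq => ni; rewrite nth_mkseq //; exact: H.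
apply: bigcup_measurable => n _; rewrite bigcup_mkcond.
apply: countable_bigcupT_measurable; first exact: countableP.
move=> s; case: ifP => // _; case: eqP => // _.
apply: bigcap_measurableType => i _; rewrite -[X in measurable X]setTI.
exact: measurable_funP.
Qed.

Definition mutually_independent d (Omega : measurableType d)
    (P : probability Omega R) d' (S : measurableType d')
    (X : nat -> {RV P >-> S}) : Prop :=
  forall (I : seq nat) (A : nat -> set S),
    uniq I -> (forall i, measurable (A i)) ->
    P (\bigcap_(i in [set` I]) (X i @^-1` A i)) =
      (\prod_(i <- I) P (X i @^-1` A i))%E.

Definition iid d (Omega : measurableType d) (P : probability Omega R)
    (X : nat -> {RV P >-> int}) (Q : probability int R) : Prop :=
  mutually_independent X /\
  forall i (A : set int), distribution P (X i) A = Q A.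

Definition type1_error_control (T : sequential_test)
    (H0 : set (probability int R)) (alpha : R) : Prop :=
  forall Q, H0 Q ->
  forall d (Omega : measurableType d) (P : probability Omega R)
    (X : nat -> {RV P >-> int}),
  iid X Q -> (P (rejection T X) <= alpha%:E)%E.

Definition power_one (T : sequential_test)
    (H1 : set (probability int R)) : Prop :=
  forall Q, H1 Q ->
  forall d (Omega : measurableType d) (P : probability Omega R)
    (X : nat -> {RV P >-> int}),
  iid X Q -> P (rejection T X) = 1%E.

(* The first observation is [head 0 x] and the remaining ones are
   [behead x]. *)
Definition unimodality_test (alpha : R) (phi : int) : sequential_test :=
  fun x =>
    let Theta := CI (head 0 x) (alpha / 3) phi `&`
                 CI (head 0 x) (alpha / 3) (- phi) in
    (2 <= size x)%N /\ ((3 / alpha)%:E <= J_set R (behead x) Theta)%E.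

End SequentialTests.

(* Main.v *)
Require Import Defs.
From mathcomp Require Import all_boot all_order all_algebra.
From mathcomp Require Import all_classical all_reals all_analysis.
From mathcomp Require Import zify ring lra.

Set Implicit Arguments.
Unset Strict Implicit.
Unset Printing Implicit Defensive.

Import Order.TTheory GRing.Theory Num.Theory.
Import numFieldNormedType.Exports.

Local Open Scope classical_set_scope.
Local Open Scope ring_scope.

(* Level: if [P] has mode [theta], then [theta] is missed by each of the two
   confidence intervals with probability at most [alpha / 3], and [J] at
   [theta] is a nonnegative supermartingale starting at most at 1, so by
   Ville's inequality it ever reaches [3 / alpha] with probability at most
   [alpha / 3].

   Power: given [X_1], only finitely many [theta] matter, so it is enough that
   [J_n(theta)] tends to infinity in probability for each [theta].  As [theta]
   is not a mode, some [m] has [f(m + 1) > f(m)] after recentring.  Betting half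
   of the empirical Kelly fraction gives, on every path, a wealth of at least
   [exp (a ^ 2 / (4 N)) / (N + 1) ^ 2], where [N] counts the observations in
   [{m, m + 1}] and [a] is the positive part of the excess of [m + 1] over [m].
   By Chernoff's bound [a] is at least of order [n], except with exponentially
   small probability. *)

(** * The wealth of the half-Kelly bettor *)

Section ExpBounds.
Variable R : realType.
Implicit Types x : R.

Lemma expR_ge1DxDsqr x : 0 <= x -> 1 + x + x ^+ 2 / 2 <= expR x.
Proof.
move=> x0; rewrite /expR.
have -> : 1 + x + x ^+ 2 / 2 = series (exp_coeff x) 3.
  rewrite /series/= !big_nat_recr//= big_geq// /exp_coeff/= expr0 expr1.
  by rewrite add0r !invr1 !mulr1.
apply: nondecreasing_cvgn_le; last exact: is_cvg_series_exp_coeff.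
by apply: nondecreasing_series => n _ _; exact: exp_coeff_ge0.
Qed.

(** Turns a product of bets into the exponential of a sum. The reciprocals are compared: for
    [x >= 0] the first-order bound on [expR] suffices, since
    [(1 - x + x ^+ 2) * (1 + x) = 1 + x ^+ 3]; for [x < 0] the second-order bound is used. *)
Lemma expR_subr_sqr_le x : `|x| <= 1 / 2 -> expR (x - x ^+ 2) <= 1 + x.
Proof.
move=> xle.
have {}xle : - (1 / 2) <= x <= 1 / 2 by rewrite -ler_norml.
rewrite -[leLHS]invrK -expRN -[leRHS]invrK lef_pV2 ?posrE ?expR_gt0 ?invr_gt0//; last lra.
have [x0|x0] := leP 0 x.
  apply: le_trans (expR_ge1Dx _).
  rewrite -[leLHS]mul1r ler_pdivrMr; last lra.
  have : 0 <= x ^+ 3 by rewrite exprn_ge0.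
  nra.
have y0 : 0 <= - (x - x ^+ 2) by nra.
apply: le_trans (expR_ge1DxDsqr y0).
rewrite -[leLHS]mul1r ler_pdivrMr; last lra.
set t := - x; have -> : x = - t by rewrite /t opprK.
have t0 : 0 < t by rewrite /t; lra.
have t1 : t <= 1/2 by rewrite /t; lra.
have -> : (1 + - (- t - (- t) ^+ 2) + (- (- t - (- t) ^+ 2)) ^+ 2 / 2) * (1 + - t)
  = 1 + t ^+ 2 / 2 * (1 - t - t ^+ 2 - t ^+ 3) by field.
rewrite lerDl mulr_ge0//; first by rewrite divr_ge0// sqr_ge0.
by nra.
Qed.

(** Lets the error [(N + 1)^-1] of each betting step be paid by the growth of a quadratic prefactor
    in [J_factor_ge]. *)
Lemma expR_le_sqr1D x : 0 <= x <= 1 -> expR x <= (1 + x) ^+ 2.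
Proof.
move=> /andP[x0 x1].
have -> : x = 2%:R * (x / 2) by field.
rewrite expRM_natl lerXn2r ?nnegrE ?expR_ge0//; first lra.
rewrite -[leLHS]invrK -expRN -[leRHS]invrK lef_pV2 ?posrE ?expR_gt0 ?invr_gt0//; last lra.
apply: le_trans (expR_ge1Dx _).
rewrite -[leLHS]mul1r ler_pdivrMr; last lra.
nra.
Qed.

End ExpBounds.

Section PathwiseWealth.
Variable R : realType.

(* Abel summation in disguise: the linear gain [l * e] of one bet raises the
   potential [a ^+ 2 / (4 * N)], and because the bet [l] is half of the Kelly
   fraction the quadratic loss [l ^+ 2] is absorbed by the change of [N]. *)
Lemma half_kelly_step (N a a' e : R) :
  N = 0 \/ 1 <= N -> 0 <= a <= N -> e ^+ 2 = 1 ->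
  a' ^+ 2 <= a ^+ 2 + 2 * a * e + 1 ->
  let l := a / (2 * N) in
  a' ^+ 2 / (4 * (N + 1)) <=
    a ^+ 2 / (4 * N) + (l * e - l ^+ 2) + (N + 1)^-1.
Proof.
move=> [->|N1] /andP[a0 aN] e1 a'le /=.
  (* Before the first bet [0 / 0 = 0]: nothing is staked, and the error term, here 1, covers
     [a' ^+ 2 / 4]. *)
  have a00 : a = 0 by lra.
  move: a'le; rewrite a00 !(mul0r, mulr0, invr0) expr0n/= subr0 !add0r invr1.
  by rewrite mulr1 ler_pdivrMr; lra.
have /orP e_cases : (e == 1) || (e == -1) by rewrite -sqrf_eq1 e1.
have N0 : 0 < N by lra.
rewrite -subr_ge0.
(* Once the slack in the bound on [a' ^+ 2] is split off, the rest of the numerator is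
   [(3 * N - a) * (N + a)] for [e = 1] and [(3 * N + a) * (N - a)] for [e = -1], nonnegative because
   [a <= N]. *)
have -> : a ^+ 2 / (4 * N) + (a / (2 * N) * e - (a / (2 * N)) ^+ 2) + (N + 1)^-1
   - a' ^+ 2 / (4 * (N + 1)) = 
   ((a ^+ 2 + 2 * a * e + 1 - a' ^+ 2) * N ^+ 2
     + (3 * N ^+ 2  + 2 * a * e * N - a ^+ 2)) / (4 * N ^+ 2 * (N + 1)).
  field. by apply/andP; split; apply: lt0r_neq0; lra.
apply: divr_ge0; last by rewrite !mulr_ge0 ?sqr_ge0//; lra.
apply: addr_ge0; first by rewrite mulr_ge0 ?sqr_ge0 ?subr_ge0.
by case: e_cases => /eqP ->; nra.
Qed.

End PathwiseWealth.

Section Bets.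
Variable R : realType.
Implicit Types (z : seq int) (m : nat).

Lemma mass_empirical z (n : int) :
  mass (empirical R z) n = (count_mem n z)%:R / (size z)%:R.
Proof.
rewrite /mass /empirical /mscale/=.
rewrite -[msum _ _ _]/(\sum_(k < size z) \d_(z`_k) [set n])%E.
under eq_bigr do rewrite diracE.
rewrite sumEFin/= mulrC; congr (_ / _).
rewrite -natr_sum -sum1_count (big_nth 0) big_mkord.
congr (_ *+ _); rewrite [RHS]big_mkcond; apply: eq_bigr => i _.
by rewrite in_set1/=; case: (_ == _).
Qed.

Lemma betting_fraction_empirical z m :
  let p : R := (count_mem m%:Z z)%:R in let q := (count_mem m.+1%:Z z)%:R in
  betting_fraction (empirical R z) m = Num.max (q - p) 0 / (2 * (p + q)).
Proof.
rewrite /betting_fraction !mass_empirical/=.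
case: z => [|x z]; first by rewrite /= !subrr maxxx !mul0r.
set s := size _; have s0 : s%:R^-1 != 0 :> R by rewrite invr_eq0 pnatr_eq0.
rewrite -mulrBl -mulrDl -[X in Num.max _ X](mul0r s%:R^-1).
rewrite -maxr_pMl ?invr_ge0// (mulrA 2) -mulf_div divff ?mulr1//.
Qed.

Lemma betting_fraction_itv (P : set int -> \bar R) m :
  0 <= mass P m%:Z -> 0 <= mass P m.+1%:Z ->
  0 <= betting_fraction P m <= 1 / 2.
Proof.
rewrite /betting_fraction; set p := mass _ _; set q := mass _ _ => p0 q0.
have m0 : 0 <= Num.max (q - p) 0 by rewrite le_max lexx orbT.
rewrite divr_ge0//=; last by rewrite mulr_ge0// addr_ge0.
have [->|pq0] := eqVneq (p + q) 0; first by rewrite mulr0 invr0 mulr0.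
have pq1 : 0 < p + q by rewrite lt_neqAle eq_sym pq0 addr_ge0.
by rewrite ler_pdivrMr ?mulr_gt0// ge_max; apply/andP; split; nra.
Qed.

Lemma betting_fraction_empirical_itv z m :
  0 <= betting_fraction (empirical R z) m <= 1 / 2.
Proof.
by apply: betting_fraction_itv; rewrite mass_empirical divr_ge0.
Qed.

Lemma evalue_empirical_gt0 z m x : 0 < evalue (empirical R z) m x.
Proof.
rewrite /evalue; have /andP[] := betting_fraction_empirical_itv z m.
set l := betting_fraction _ _ => l0 l1.
by case: (x == _); case: (x == _) => /=; rewrite ?oppr0; nra.
Qed.

Lemma J_factor_rcons m z x :
  J_factor R m (rcons z x) = J_factor R m z * evalue (empirical R z) m x.
Proof.
rewrite /J_factor size_rcons big_ord_recr/=; congr (_ * _).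
  apply: eq_bigr => i _; rewrite nth_rcons ltn_ord.
  by rewrite -cats1 take_cat ltn_ord.
by rewrite -cats1 take_size_cat// nth_cat ltnn subnn.
Qed.

Lemma J_factor_nil m : J_factor R m [::] = 1.
Proof. by rewrite /J_factor big_ord0. Qed.

Lemma J_factor_gt0 m z : 0 < J_factor R m z.
Proof.
elim/last_ind: z => [|z x IH]; first by rewrite J_factor_nil.
by rewrite J_factor_rcons mulr_gt0// evalue_empirical_gt0.
Qed.

(** Induction along the sequence: an observation in [{m, m + 1}] is one [half_kelly_step], and any
    other changes neither side. The errors [(N + 1)^-1] form a harmonic sum, whose exponential the
    factor [(p + q + 1) ^+ 2] absorbs. *)
Lemma J_factor_ge m z :
  let p : R := (count_mem m%:Z z)%:R in let q := (count_mem m.+1%:Z z)%:R in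
  expR (Num.max (q - p) 0 ^+ 2 / (4 * (p + q))) <=
    (p + q + 1) ^+ 2 * J_factor R m z.
Proof.
elim/last_ind: z => [|z x IH].
  by rewrite J_factor_nil/= subrr addr0 mulr0 invr0 mulr0 expR0 add0r expr1n mulr1.
rewrite J_factor_rcons /evalue betting_fraction_empirical/=.
rewrite -!cats1 !count_cat/= !addn0 !natrD.
move: IH => /=.
set p : R := (count_mem m%:Z z)%:R; set q : R := (count_mem m.+1%:Z z)%:R.
set J := J_factor R m z => IH.
have J0 : 0 < J by exact: J_factor_gt0.
set a := Num.max (q - p) 0.
have a0 : 0 <= a by rewrite le_max lexx orbT.
have p0 : 0 <= p by []. have q0 : 0 <= q by [].
have apq : a <= p + q by rewrite ge_max; apply/andP; split; lra.
have pq1 : p + q = 0 \/ 1 <= p + q.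
  rewrite -natrD; case: (_ + _)%N => [|k]; first by left.
  by right; rewrite ler1n.
(* Both relevant outcomes at once: [e] is 1 when [m + 1] is observed and -1 when [m] is. *)
have key (e p' q' : R) : e ^+ 2 = 1 -> p' + q' = p + q + 1 ->
    q' - p' = q - p + e ->
    expR (Num.max (q' - p') 0 ^+ 2 / (4 * (p' + q'))) <=
    (p' + q' + 1) ^+ 2 * (J * (1 + a / (2 * (p + q)) * e)).
  move=> e1 -> ->; set a' := Num.max _ _.
  have a'le : a' ^+ 2 <= a ^+ 2 + 2 * a * e + 1.
    have /orP e_cases : (e == 1) || (e == -1) by rewrite -sqrf_eq1 e1.
    rewrite /a' /a.
    case: (leP (q - p) 0) => h1; case: (leP (q - p + e) 0) => h2;
      case: e_cases => /eqP ee; subst e; nra.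
  have a_itv : 0 <= a <= p + q by rewrite a0.
  have /= := half_kelly_step pq1 a_itv e1 a'le.
  set l := a / _; set N := p + q => step.
  have N0 : 0 <= N by rewrite addr_ge0.
  have l_itv : 0 <= l <= 1 / 2.
    rewrite /l -/N divr_ge0//= ?mulr_ge0//.
    have [->|N_0] := eqVneq N 0; first by rewrite mulr0 invr0 mulr0.
    have N_1 : 0 < N by rewrite lt_neqAle eq_sym N_0.
    by rewrite ler_pdivrMr ?mulr_gt0// /N; lra.
  have le1 : `|l * e| <= 1 / 2.
    have /orP[] : (e == 1) || (e == -1) by rewrite -sqrf_eq1 e1.
      by move=> /eqP->; rewrite mulr1 ger0_norm; lra.
    by move=> /eqP->; rewrite mulrN1 normrN ger0_norm; lra.
  have := expR_subr_sqr_le le1; rewrite exprMn e1 mulr1 => exple.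
  have N1 : 0 <= (N + 1)^-1 <= 1.
    by rewrite invr_ge0 addr_ge0//= invf_le1; lra.
  have exp1 := expR_le_sqr1D N1.
  apply: (@le_trans _ _ (expR (a ^+ 2 / (4 * N) + (l * e - l ^+ 2) + (N + 1)^-1))).
    by rewrite ler_expR.
  rewrite expRD [X in X * _]expRD.
  (* The prefactor grows by [(1 + (N + 1)^-1) ^+ 2], which dominates [expR (N + 1)^-1]. *)
  have -> : (N + 1 + 1) ^+ 2 * (J * (1 + l * e)) =
    ((N + 1) ^+ 2 * J) * (1 + l * e) * (1 + (N + 1)^-1) ^+ 2.
    by field; apply: lt0r_neq0; lra.
  apply: ler_pM => //; rewrite ?mulr_ge0 ?expR_ge0//.
  by apply: ler_pM; rewrite ?expR_ge0.
have [xm|xm] := eqVneq x m%:Z.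
  have -> : (x == m.+1%:Z) = false by rewrite xm eqz_nat ltn_eqF.
  rewrite addr0; apply: key => //=; rewrite ?sqrrN ?expr1n//; lra.
have [xm1|xm1] := eqVneq x m.+1%:Z.
  rewrite oppr0 add0r; apply: key => //=; rewrite ?expr1n//; lra.
by rewrite /= oppr0 !addr0 mulr0 addr0 mulr1.
Qed.

End Bets.

(** * Ville's inequality *)

Section Ville.
Context d (Omega : measurableType d) (R : realType) (P : probability Omega R).
Variables (X : nat -> {RV P >-> int}) (Q : probability int R).
Hypothesis iidXQ : iid X Q.
Implicit Types (s : seq int) (x : int).

(** An event about the first [n] observations is the rejection event of a test that can stop only at
    length [n]. *)
Lemma measurable_mkseq (Y : nat -> {RV P >-> int}) n (B : set (seq int)) :
  measurable [set w | B (mkseq (Y ^~ w) n)].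
Proof.
rewrite (_ : [set _ | _] = rejection (fun s => size s = n /\ B s) Y).
  exact: measurable_rejection.
rewrite eqEsubset; split => [w /= Bw|w [k /=]].
  by exists n; rewrite size_mkseq.
by rewrite size_mkseq => -[->].
Qed.

Lemma distribution_iid i (A : set int) : P (X i @^-1` A) = Q A.
Proof. exact: iidXQ.2. Qed.

Lemma probability_prefix s :
  P [set w | mkseq (X ^~ w) (size s) = s] = (\prod_(x <- s) Q [set x])%E.
Proof.
rewrite (_ : [set _ | _] =
    \bigcap_(i in [set` iota 0 (size s)]) X i @^-1` [set s`_i]).
  rewrite (iidXQ.1 _ (fun i => [set s`_i])) ?iota_uniq//.
  rewrite [RHS](big_nth 0) /index_iota subn0.
  by apply: eq_bigr => i _; rewrite distribution_iid.
rewrite eqEsubset; split => [w /= Xs i /=|w Xs /=].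
  by rewrite mem_iota/= add0n => ils; rewrite -[in RHS]Xs nth_mkseq.
apply: (@eq_from_nth _ 0); first by rewrite size_mkseq.
move=> i; rewrite size_mkseq => ils; rewrite nth_mkseq//.
by apply: Xs => /=; rewrite mem_iota.
Qed.

Lemma probability_prefix_rcons s x :
  P [set w | mkseq (X ^~ w) (size (rcons s x)) = rcons s x] =
  (P [set w | mkseq (X ^~ w) (size s) = s] * Q [set x])%E.
Proof. by rewrite !probability_prefix big_rcons/= muleC. Qed.

Variable V : seq int -> \bar R.
Hypothesis V_ge0 : forall s, (0 <= V s)%E.
Hypothesis V_super : forall s, (\int[Q]_x V (rcons s x) <= V s)%E.

Let hit (c : R) s k := [set w | mkseq (X ^~ w) (size s) = s /\
  exists2 j, (j <= k)%N & (c%:E <= V (mkseq (X ^~ w) (size s + j)))%E].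

Let measurable_hit c s k : measurable (hit c s k).
Proof.
rewrite (_ : hit c s k = [set w | mkseq (X ^~ w) (size s) = s] `&`
  \bigcup_(j in [set j | (j <= k)%N])
     [set w | (c%:E <= V (mkseq (X ^~ w) (size s + j)))%E]).
  apply: measurableI; first exact: (measurable_mkseq _ _ [set s]).
  apply: bigcup_measurable => j _.
  exact: (measurable_mkseq _ _ [set s | (c%:E <= V s)%E]).
by rewrite eqEsubset; split => [w [? [j]]|w [? [j]]]; split => //; exists j.
Qed.

(* Bounding the hitting probability jointly with every prefix [s] makes the
   induction on the horizon [k] work without conditional expectations. *)
Let ville_finite (c : R) s k : 0 <= c ->
  (c%:E * P (hit c s k) <= P [set w | mkseq (X ^~ w) (size s) = s] * V s)%E.
Proof.
move=> c0; elim: k s => [|k IH] s; have [cV|Vc] := leP c%:E (V s).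
(* If [V s] has already reached [c], the prefix event itself is a sufficient bound. *)
1,3: rewrite muleC; apply: lee_pmul => //; apply: le_measure;
  rewrite ?inE; [exact: measurable_hit|exact: (measurable_mkseq _ _ [set s])|];
  by move=> w [].
  rewrite (_ : hit c s 0 = set0) ?measure0 ?mule0 ?mule_ge0//.
  rewrite -subset0 => w [/= ws [j]]; rewrite leqn0 => /eqP->.
  by rewrite addn0 ws leNgt Vc.
(* The next observation splits the event into countably many pieces, indexed by integer codes;
   indices that code no integer give empty pieces. *)
pose F i := if pickle_inv i is Some x then hit c (rcons s x) k else set0.
pose G i := [set x : int | pickle x = i].
have G_Some i x : pickle_inv i = Some x -> G i = [set x].
  move=> ix; rewrite eqEsubset; split=> [y /= yi|_ ->] /=.
    by move: ix; rewrite -yi pickleK_inv => -[].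
  by have := @pickle_invK int i; rewrite ix.
have mF i : measurable (F i) by rewrite /F; case: (pickle_inv _).
have sub : hit c s k.+1 `<=` \bigcup_i F i.
  move=> w [/= ws [[_|j jk]]]; first by rewrite addn0 ws leNgt Vc.
  have wsr : mkseq (X ^~ w) (size s).+1 = rcons s (X (size s) w).
    by rewrite /mkseq -addn1 iotaD map_cat -[map _ _]/(mkseq _ _) ws cats1.
  move=> cV; exists (pickle (X (size s) w)); first exact: I.
  rewrite /F pickleK_inv /hit/= size_rcons; split=> //.
  by exists j => //; rewrite addSnnS.
have Pk0 A : (0 <= P A)%E by [].
apply: (@le_trans _ _ (c%:E * (\sum_(0 <= i <oo) P (F i)))%E).
  by rewrite lee_pmul// measure_sigma_subadditive.
rewrite -nneseriesZl//.
apply: (@le_trans _ _ (\sum_(0 <= i <oo)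
    P [set w | mkseq (X ^~ w) (size s) = s] * \int[Q]_(x in G i) V (rcons s x))%E).
  apply: lee_nneseries => [i _ _|i _]; first by rewrite mule_ge0.
  rewrite /F; case E : (pickle_inv i) => [x|]; last first.
    by rewrite measure0 mule0 mule_ge0// integral_ge0.
  apply: le_trans (IH (rcons s x)) _.
  rewrite probability_prefix_rcons (G_Some _ _ E) -muleA.
  rewrite (_ : (\int[Q]_(y in [set x]) _)%E = (V (rcons s x) * Q [set x])%E).
    by rewrite [X in (_ * X)%E]muleC.
  rewrite -integral_cst//; apply: eq_integral => y.
  by rewrite inE => ->.
have <- : (fine (P [set w | mkseq (X ^~ w) (size s) = s]))%:E =
    P [set w | mkseq (X ^~ w) (size s) = s].
  by rewrite fineK// fin_num_measure//; exact: (measurable_mkseq _ _ [set s]).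
rewrite nneseriesZl; last by move=> i _; rewrite integral_ge0.
(* The [G i] partition the integers, so the sum is the full integral, to which [V_super] applies. *)
rewrite -ge0_integral_bigcup//; last 1 first.
  by move=> i j _ _ [x [<- <-]].
rewrite lee_pmul// ?integral_ge0//; first by rewrite lee_fin fine_ge0.
rewrite (_ : \bigcup_k G k = setT)//.
by rewrite -subTset => x _; exists (pickle x).
Qed.

(** [ville_finite] at the empty prefix, with the horizon sent to infinity by continuity from
    below. *)
Lemma ville (c : R) : 0 < c ->
  (c%:E * P (rejection (fun s => (c%:E <= V s)%E) X) <= V [::])%E.
Proof.
move=> c0.
have rejE : rejection (fun s => (c%:E <= V s)%E) X = \bigcup_k hit c [::] k.
  rewrite eqEsubset; split=> [w [n Vn]|w [k _ [_ [j _ Vj]]]].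
    by exists n => //; split => //; exists n.
  by exists j.
have mrej : measurable (\bigcup_k hit c [::] k).
  by apply: bigcup_measurable => k _; exact: measurable_hit.
have cv : (P \o hit c [::]) x @[x --> \oo] --> P (\bigcup_k hit c [::] k).
  apply: nondecreasing_cvg_mu => //.
  move=> n m nm; apply/subsetPset => w [/= _ [j jn Vj]]; split => //.
  by exists j => //; exact: leq_trans nm.
rewrite rejE -(cvg_lim _ cv)// -lee_pdivlMl//.
apply: lime_le; first by apply/cvg_ex; exists (P (\bigcup_k hit c [::] k)).
near=> k; rewrite /= lee_pdivlMl//.
by have := ville_finite [::] k (ltW c0); rewrite probability_prefix big_nil mul1e.
Unshelve. all: by end_near. Qed.

End Ville.

(** * The supermartingale property of [J] *)

Section BetIntegral.
Variables (R : realType) (Q : probability int R).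

Lemma massK (n : int) : (mass Q n)%:E = Q [set n].
Proof. by rewrite /mass fineK// fin_num_measure. Qed.

Lemma mass_ge0 (n : int) : 0 <= mass Q n.
Proof. by rewrite /mass fine_ge0. Qed.

(** Used for the e-values in [J] and, with [t] as the stake, for the martingale in
    [count_deviation]. *)
Lemma integral_bet (u v : int) (l : R) : 0 <= l <= 1 ->
  (\int[Q]_x (1 + l * (- (x == u)%:R + (x == v)%:R))%:E =
   (1 + l * (mass Q v - mass Q u))%:E)%E.
Proof.
move=> /andP[l0 l1].
set f := fun x : int => 1 + l * (- (x == u)%:R + (x == v)%:R).
have f0 x : (0 <= (f x)%:E)%E.
  by rewrite lee_fin /f; case: (x == u); case: (x == v) => /=; rewrite ?oppr0; nra.
have Il0 (n : int) x : (0 <= (l * \1_[set n] x)%:E)%E.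
  by rewrite lee_fin mulr_ge0.
have Il (n : int) : (\int[Q]_x (l * \1_[set n] x)%:E = (l * mass Q n)%:E)%E.
  under eq_integral do rewrite EFinM.
  rewrite ge0_integralZl_EFin//.
  by rewrite integral_indic// setIT EFinM massK.
have I1 : (\int[Q]_x 1 = 1)%E.
  by rewrite (integral_cst Q measurableT 1%:E) mul1e; exact: probability_setT.
(* Adding [l * \1_u] to both sides leaves only nonnegative integrands. *)
have : (\int[Q]_x ((f x)%:E + (l * \1_[set u] x)%:E) =
        \int[Q]_x (1%:E + (l * \1_[set v] x)%:E))%E.
  apply: eq_integral => x _; rewrite -!EFinD /f !indicE !in_set1.
  by congr (_%:E); ring.
rewrite !ge0_integralD// !Il I1.
move=> /(congr1 (fun z => z - (l * mass Q u)%:E)%E).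
rewrite addeK// => ->.
by congr (_%:E); ring.
Qed.

End BetIntegral.

Section JSupermartingale.
Variable R : realType.
Implicit Types (y : seq int) (theta : int).

Let J_term_ge0 y z m :
  (0 <= (2 ^- m.+2 * (J_factor R m y + J_factor R m z))%:E)%E.
Proof.
by rewrite lee_fin mulr_ge0 ?invr_ge0 ?exprn_ge0// addr_ge0// ltW// J_factor_gt0.
Qed.

Lemma J_ge0 y theta : (0 <= J R y theta)%E.
Proof. by apply: nneseries_ge0 => m _ _; exact: J_term_ge0. Qed.

Lemma J_ge m y theta :
  ((2 ^- m.+2 * J_factor R m [seq yi - theta | yi <- y])%:E <= J R y theta)%E /\
  ((2 ^- m.+2 * J_factor R m [seq theta - yi | yi <- y])%:E <= J R y theta)%E.
Proof.
have Jm : ((2 ^- m.+2 * (J_factor R m [seq yi - theta | yi <- y] +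
                   J_factor R m [seq theta - yi | yi <- y]))%:E <= J R y theta)%E.
  apply: (@le_trans _ _ (\sum_(0 <= m < m.+1)
     (2 ^- m.+2 * (J_factor R m [seq yi - theta | yi <- y] +
                   J_factor R m [seq theta - yi | yi <- y]))%:E)%E).
    rewrite big_nat_recr//= leeDr// sume_ge0// => k _; exact: J_term_ge0.
  by apply: nneseries_lim_ge => k _ _; exact: J_term_ge0.
split; apply: le_trans Jm; rewrite lee_fin ler_pM2l ?invr_gt0 ?exprn_gt0//.
  by rewrite lerDl ltW// J_factor_gt0.
by rewrite lerDr ltW// J_factor_gt0.
Qed.

Lemma J_nil theta : (J R [::] theta <= 1)%E.
Proof.
have sumE n : \sum_(0 <= m < n) (2 ^- m.+2 * (1 + 1)) = 1 - 2 ^- n :> R.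
  elim: n => [|n IH]; first by rewrite big_geq// expr0 invr1 subrr.
  rewrite big_nat_recr//= IH !exprS.
  by field; rewrite expf_neq0.
apply: lime_le.
  by apply: is_cvg_nneseries => m _ _; exact: J_term_ge0.
near=> n.
under eq_bigr do rewrite /= !J_factor_nil.
by rewrite sumEFin sumE lee_fin gerBl invr_ge0 exprn_ge0.
Unshelve. all: by end_near. Qed.

(** Every factor stakes a nonnegative fraction, fixed by the past, on the farther of two neighbours
    on one side of [theta]. Under a mode at [theta] that neighbour is not the likelier one, so each
    bet has mean at most 1, whatever the empirical measure; sum and integral commute by
    nonnegativity. *)
Lemma J_supermartingale (Q : probability int R) theta y :
  unimodal_at theta Q -> (\int[Q]_x J R (rcons y x) theta <= J R y theta)%E.
Proof.
move=> [Qle Qge]; rewrite /J integral_nneseries//.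
apply: lee_nneseries => [m _ _|m _].
  by apply: integral_ge0 => x _; exact: J_term_ge0.
set a := J_factor R m [seq yi - theta | yi <- y].
set b := J_factor R m [seq theta - yi | yi <- y].
have a0 : 0 < a by exact: J_factor_gt0.
have b0 : 0 < b by exact: J_factor_gt0.
pose e z (x : int) := evalue (empirical R z) m x.
set za := [seq yi - theta | yi <- y]; set zb := [seq theta - yi | yi <- y].
have e0 z x : (0 <= (e z x)%:E)%E by rewrite lee_fin ltW// evalue_empirical_gt0.
have Ie z (g : int -> int) u v : (forall x, (g x == m%:Z) = (x == u)) ->
    (forall x, (g x == m.+1%:Z) = (x == v)) -> mass Q v <= mass Q u ->
    (\int[Q]_x (e z (g x))%:E <= 1)%E.
  move=> gu gv Quv; have /andP[l0 l1] := betting_fraction_empirical_itv R z m.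
  under eq_integral do rewrite /e /evalue gu gv.
  rewrite integral_bet; last by rewrite l0/=; lra.
  by rewrite lee_fin gerDl mulr_ge0_le0// subr_le0.
have c0 : 0 <= 2 ^- m.+2 :> R by rewrite invr_ge0 exprn_ge0.
under eq_integral do rewrite !map_rcons !J_factor_rcons EFinM EFinD !EFinM.
have a0E : (0 <= a%:E)%E by rewrite lee_fin ltW.
have b0E : (0 <= b%:E)%E by rewrite lee_fin ltW.
have ae0 z x : (0 <= a%:E * (e z x)%:E)%E by rewrite mule_ge0.
have be0 z x : (0 <= b%:E * (e z x)%:E)%E by rewrite mule_ge0.
rewrite ge0_integralZl_EFin//; last first.
  by move=> x _; apply: adde_ge0; [exact: ae0|exact: be0].
rewrite EFinM lee_wpmul2l ?lee_fin//.
rewrite ge0_integralD//; last 2 first.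
- by move=> x _; exact: ae0.
- by move=> x _; exact: be0.
have a0' := ltW a0; have b0' := ltW b0.
rewrite !ge0_integralZl_EFin//; last 2 first.
- by move=> x _; exact: e0.
- by move=> x _; exact: e0.
rewrite EFinD leeD//.
  rewrite -[leRHS]mule1 lee_wpmul2l//.
  apply: (Ie za (fun x => x - theta) (theta + m%:Z) (theta + m%:Z + 1)).
  - by move=> x; rewrite subr_eq addrC.
  - by move=> x; rewrite subr_eq -addn1 PoszD addrC addrA.
  - by apply: Qge; rewrite lerDl.
rewrite -[leRHS]mule1 lee_wpmul2l//.
apply: (Ie zb (fun x => theta - x) (theta - m%:Z) (theta - m%:Z - 1)).
- by move=> x; rewrite subr_eq eq_sym [RHS]eq_sym subr_eq addrC.
- by move=> x; apply/eqP/eqP; lia.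
- by apply: Qle; rewrite gerBl.
Qed.

End JSupermartingale.

(** * Coverage of the confidence interval *)

Section Coverage.
Variable R : realType.

(** Compares the mean of the [k] smallest values with the mean of all, cleared of denominators.
    Passing from [d] to [d + 1] adds the first [k] terms on the left and [k] copies of the
    dominating term [g d] on the right. *)
Lemma le_sum_smallest (g : nat -> R) (k d : nat) : (k <= d)%N ->
  (forall i j, (i <= j < d)%N -> g i <= g j) ->
  d%:R * (\sum_(i < k) g i) <= k%:R * (\sum_(i < d) g i).
Proof.
elim: d => [|d IH]; first by rewrite leqn0 => /eqP->; rewrite !big_ord0.
rewrite leq_eqVlt => /orP[/eqP<-//|]; rewrite ltnS => kd gle.
rewrite big_ord_recr/= mulrDr -natr1 mulrDl mul1r lerD//.
  by apply: IH => // i j /andP[ij jd]; rewrite gle// ij ltnW.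
have -> : k%:R * g d = \sum_(i < k) g d by rewrite sumr_const card_ord mulr_natl.
by apply: ler_sum => i _; apply: gle; rewrite ltnSn andbT (leq_trans _ kd)// ltnW.
Qed.

(** The sign [sg] orients the line from [phi] towards the mode, so one monotonicity statement covers
    both positions of the mode and both sides of [phi]. *)
Lemma unimodal_at_ray (Q : probability int R) (theta phi sg : int) (d : nat) :
  unimodal_at theta Q -> sg = 1 \/ sg = -1 -> theta = phi + sg * d%:Z ->
  forall a b : int, a <= b -> b <= d%:Z ->
  mass Q (phi + sg * a) <= mass Q (phi + sg * b).
Proof.
move=> [Qle Qge] sg1 thetaE a b ab bd.
have [n ->] : exists n : nat, a = b - n%:Z.
  by exists `|b - a|%N; rewrite gez0_abs ?subr_ge0// opprB addrC subrK.
elim: n => [|n IH]; first by rewrite subr0.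
apply: le_trans IH; set c := b - n%:Z.
have -> : b - n.+1%:Z = c - 1 by rewrite /c; lia.
have cd : c <= d%:Z by rewrite /c; lia.
case: sg1 thetaE => -> thetaE.
  have -> : phi + 1 * (c - 1) = phi + 1 * c - 1 by lia.
  by apply: Qle; lia.
have -> : phi + -1 * (c - 1) = phi + -1 * c + 1 by lia.
by apply: Qge; lia.
Qed.

(* An uncovered [x] lies, on either side of [phi], within [d * beta / 2] of
   [phi], where [d] is the distance from [phi] to the mode.  The [k] points on
   the side of the mode are the [k] least likely among the [d] points up to the
   mode, and those on the other side are even less likely. *)
Lemma CI_coverage (Q : probability int R) (theta phi : int) (beta : R) :
  0 < beta <= 1 -> unimodal_at theta Q ->
  (Q [set x | ~ CI x beta phi theta] <= beta%:E)%E.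
Proof.
move=> /andP[b0 b1] Qtheta.
have [sg [d [sg1 thetaE]]] : exists sg : int, exists d : nat,
    (sg = 1 \/ sg = -1) /\ theta = phi + sg * d%:Z.
  have [pt|tp] := leP phi theta.
    by exists 1, `|theta - phi|%N; split; [left|lia].
  by exists (-1), `|theta - phi|%N; split; [right|lia].
have ray := unimodal_at_ray Qtheta sg1 thetaE.
pose h (n : int) := mass Q (phi + sg * n).
have sg_inj (m n : int) : phi + sg * m = phi + sg * n -> m = n.
  by case: sg1 => ->; lia.
have sum1 : \sum_(i < d) h i.+1%:Z <= 1.
  rewrite -lee_fin -sumEFin.
  rewrite -(eq_bigr _ (fun i _ => esym (massK Q (phi + sg * (i : 'I_d).+1%:Z)))).
  rewrite -(measure_bigsetU Q (F := fun i => [set phi + sg * i.+1%:Z]))//.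
    exact: probability_le1.
  by move=> i j _ _ [x [/= -> /sg_inj]]; lia.
(* An uncovered [x] at distance [n] from [phi] satisfies [(2 / beta + 1) * n <= n + d], that is
   [n <= d * beta / 2]. The point [phi] itself is always covered, hence the distances [i.+1]
   below. *)
pose k := Num.truncn (d%:R * beta / 2).
have d0 : 0 <= d%:R * beta / 2 by rewrite divr_ge0// mulr_ge0// ltW.
have kle : k%:R <= d%:R * beta / 2 by rewrite truncn_le.
have kd : (k <= d)%N.
  rewrite -(ler_nat R); apply: le_trans kle _.
  have : 0 <= d%:R :> R by [].
  nra.
(* Both sides of [phi] carry at most twice the mass of the mode's side, hence at most
   [2 * k / d <= beta]; for [d = 0] the sum is empty. *)
have sum2 : \sum_(i < k) (h i.+1%:Z + h (- i.+1%:Z)) <= beta.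
  have [d_eq0|d_gt0] := posnP d.
    by move: kd; rewrite d_eq0 leqn0 => /eqP->; rewrite big_ord0 ltW.
  have dR : 0 < d%:R :> R by rewrite ltr0n.
  rewrite -(ler_pM2l dR).
  have /= smallest := @le_sum_smallest (fun i => h i.+1%:Z) k d kd.
  apply: (@le_trans _ _ (2 * (d%:R * \sum_(i < k) h i.+1%:Z))).
    rewrite mulrCA ler_pM2l// mulr_sumr; apply: ler_sum => i _.
    rewrite mulr_natl mulr2n lerD2l; apply: ray; first by lia.
    by have := ltn_ord i; lia.
  apply: (@le_trans _ _ (2 * (k%:R * \sum_(i < d) h i.+1%:Z))).
    rewrite ler_pM2l//; apply: smallest => i j /andP[ij jd].
    by apply: ray; lia.
  have : 0 <= k%:R :> R by [].
  nra.
pose F i := [set phi + sg * i.+1%:Z] `|` [set phi + sg * (- i.+1%:Z)].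
apply: (@le_trans _ _ (\sum_(i < k) Q (F i))%E); last first.
  apply: (@le_trans _ _ (\sum_(i < k) (h i.+1%:Z + h (- i.+1%:Z))%:E)%E).
    apply: lee_sum => i _; rewrite /F EFinD /h !massK.
    exact: measureU2.
  by rewrite sumEFin lee_fin.
apply: content_subadditive => // x /=.
rewrite /CI; case: (eqVneq x phi) => [_ /(_ I)//|xphi].
move=> /negP xnot; rewrite -bigcup_mkord.
have [n [n0 xE]] : exists n : nat, (0 < n)%N /\
    (x = phi + sg * n%:Z \/ x = phi + sg * (- n%:Z)).
  by exists `|x - phi|%N; case: sg1 => ->; lia.
exists n.-1; last first.
  by rewrite /F prednK.
rewrite /= /k truncn_gt_nat prednK//.
have absE : `|x%:~R - phi%:~R| = n%:R :> R.
  rewrite -intrB -intr_norm -[n%:R]/(n%:Z%:~R); congr (_%:~R).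
  by case: sg1 xE => -> [] ->; lia.
move: xnot; rewrite absE.
have : `|x%:~R - theta%:~R| <= n%:R + d%:R :> R.
  rewrite -intrB -intr_norm -[n%:R]/(n%:Z%:~R) -[d%:R]/(d%:Z%:~R) -intrD ler_int.
  by rewrite thetaE; case: sg1 xE => -> [] ->; lia.
rewrite ler_norml => /andP[lo hi].
move=> xnot; rewrite leNgt; apply: contra xnot => nlt.
have nlt' : d%:R < 2 / beta * n%:R :> R.
  by rewrite mulrAC ltr_pdivlMr//; lra.
by apply/andP; split; lra.
Qed.

End Coverage.

(** * Error control and power *)

Section TypeOne.
Context d (Omega : measurableType d) (R : realType) (P : probability Omega R).
Variables (X : nat -> {RV P >-> int}) (Q : probability int R).
Hypothesis iidXQ : iid X Q.

(** The first observation is spent on the confidence set: from the empty history the process stays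
    at [V [::]], and afterwards it moves as [V] does. *)
Lemma ville_behead (V : seq int -> \bar R) (c : R) :
  (forall s, 0 <= V s)%E ->
  (forall s, \int[Q]_x V (rcons s x) <= V s)%E -> 0 < c ->
  (c%:E * P (rejection (fun s => (c%:E <= V (behead s))%E) X) <= V [::])%E.
Proof.
move=> V0 V_super c0.
apply: (@ville _ _ _ _ _ Q iidXQ (fun s => V (behead s))) => //.
move=> [|y s]; last exact: V_super.
rewrite [leLHS](integral_cst Q measurableT (V [::])).
by rewrite [X in (_ * X)%E](_ : _ = 1%E) ?mule1//; exact: probability_setT.
Qed.

Lemma rejection_unimodal_le (alpha : R) (phi theta : int) :
  0 < alpha < 1 -> unimodal_at theta Q ->
  (P (rejection (unimodality_test alpha phi) X) <= alpha%:E)%E.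
Proof.
move=> /andP[a0 a1] Qtheta.
have a3 : 0 < alpha / 3 <= 1 by lra.
pose A psi := X 0 @^-1` [set x | ~ CI x (alpha / 3) psi theta].
pose B := rejection (fun s => ((3 / alpha)%:E <= J R (behead s) theta)%E) X.
have mA psi : measurable (A psi).
  by rewrite /A -[X in measurable X]setTI; exact: measurable_funP.
have mB : measurable B by exact: measurable_rejection.
have PA psi : (P (A psi) <= (alpha / 3)%:E)%E.
  by rewrite (distribution_iid iidXQ); exact: CI_coverage.
have PB : (P B <= (alpha / 3)%:E)%E.
  have c0 : 0 < 3 / alpha by rewrite divr_gt0.
  have := ville_behead (fun s => J_ge0 R s theta)
    (fun s => J_supermartingale s Qtheta) c0.
  move=> /le_trans/(_ (J_nil R theta)); rewrite -lee_pdivlMl// mule1.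
  by rewrite invf_div.
(* If both intervals cover [theta], then [theta] competes in the infimum, and rejection forces
   [B]. *)
apply: (@le_trans _ _ (P (A phi `|` A (- phi) `|` B))).
  apply: le_measure; rewrite ?inE; [exact: measurable_rejection| |].
    by apply: measurableU => //; exact: measurableU.
  move=> w [[|n] [//= n2 Jge]].
  have [Cphi|] := pselect (CI (X 0 w) (alpha / 3) phi theta); last by left; left.
  have [Cphi'|] := pselect (CI (X 0 w) (alpha / 3) (- phi) theta); last by left; right.
  right; exists n.+1; apply: (le_trans Jge).
  by apply: ereal_inf_lbound; exists theta.
apply: le_trans (measureU2 P (measurableU _ _ (mA _) (mA _)) mB) _.
apply: (@le_trans _ _ ((alpha / 3)%:E + (alpha / 3)%:E + (alpha / 3)%:E)%E).
  apply: leeD => //; apply: le_trans (measureU2 P (mA _) (mA _)) _.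
  by apply: leeD; exact: PA.
by rewrite -!EFinD lee_fin; lra.
Qed.

End TypeOne.

(** * Large deviations of the counts, and power *)

Section Power.
Context d (Omega : measurableType d) (R : realType) (P : probability Omega R).
Variables (X : nat -> {RV P >-> int}) (Q : probability int R).
Hypothesis iidXQ : iid X Q.

Lemma mass_le1 (n : int) : mass Q n <= 1.
Proof. by rewrite -lee_fin massK probability_le1. Qed.

(* Chernoff's method: [W] is a martingale, and it is large whenever the counts
   deviate. *)
Lemma count_deviation (u v : int) (delta : R) (n : nat) :
  0 < delta -> mass Q v = mass Q u + delta ->
  (P [set w | let s := behead (mkseq (X ^~ w) n.+1) in
       ((count_mem v s)%:R - (count_mem u s)%:R < delta / 2 * n%:R)%R]
   <= (expR (- (delta ^+ 2 / 16 * n%:R)))%:E)%E.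
Proof.
move=> delta0 uv.
have delta1 : delta <= 1 by have := mass_le1 v; have := mass_ge0 Q u; lra.
(* On the deviation event the exponent of [W] is at least [n * (t * delta / 2 - t ^+ 2)]; this [t]
   maximises it, with value [delta ^+ 2 / 16 * n]. The divisor [D] is the mean of [1 + t * xi x]. *)
pose t := delta / 4.
pose D := 1 - t * delta.
have D0 : 0 < D by rewrite /D /t; nra.
pose xi x : R := - (x == v)%:R + (x == u)%:R.
pose W s := \prod_(x <- s) ((1 + t * xi x) / D).
have t_itv : 0 <= t <= 1 by rewrite /t; lra.
have xi_abs x : `|t * xi x| <= 1 / 2.
  rewrite /xi ler_norml /t.
  by case: (x == v); case: (x == u) => /=; rewrite ?oppr0; apply/andP; split; lra.
have f0 x : 0 <= 1 + t * xi x by have := xi_abs x; rewrite ler_norml; lra.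
have W0 s : 0 <= W s.
  by apply: prodr_ge0 => x _; rewrite divr_ge0// ltW.
have W_super s : (\int[Q]_x (W (rcons s x))%:E <= (W s)%:E)%E.
  have WE x : W (rcons s x) = W s / D * (1 + t * xi x).
    by rewrite /W big_rcons/= -/(W s); ring.
  under eq_integral do rewrite WE EFinM.
  rewrite ge0_integralZl_EFin//; last 2 first.
  - by move=> x _; rewrite lee_fin.
  - by rewrite divr_ge0// ltW.
  rewrite integral_bet// uv opprD addNKr mulrN -EFinM lee_fin -mulrA.
  by rewrite mulVf ?mulr1// lt0r_neq0.
have W_ge s : expR ((count_mem u s)%:R * t - (count_mem v s)%:R * t
    - (size s)%:R * t ^+ 2 + (size s)%:R * (t * delta)) <= W s.
  elim: s => [|x s IH].
    by rewrite /W big_nil/= !mul0r !subr0 addr0 expR0.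
  rewrite /W big_cons -/(W s) /= !natrD -natr1.
  have := expR_subr_sqr_le (xi_abs x) => ex.
  have eD : expR (t * delta) <= D^-1.
    rewrite -[leLHS]invrK -expRN lef_pV2 ?posrE ?expR_gt0//.
    exact: expR_ge1Dx.
  have := ler_pM (expR_ge0 _) (expR_ge0 _) ex eD.
  rewrite -expRD => step.
  apply: le_trans (ler_pM (expR_ge0 _) (expR_ge0 _) step IH).
  rewrite -expRD ler_expR.
  have : (t * xi x) ^+ 2 <= t ^+ 2.
    rewrite exprMn ler_piMr ?sqr_ge0//.
    by rewrite /xi; case: (x == v); case: (x == u) => /=; rewrite ?oppr0; nra.
  move: (_ ^+ 2) => z zt; rewrite /xi.
  by move: zt; lra.
have c0 : 0 < expR (delta ^+ 2 / 16 * n%:R) by exact: expR_gt0.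
have := @ville_behead _ _ _ _ _ _ iidXQ (fun s => (W s)%:E) _
  (fun s => W0 s) W_super c0.
rewrite {2}/W big_nil -lee_pdivlMl// mule1 expRN; apply: le_trans.
apply: le_measure; rewrite ?inE.
- exact: (measurable_mkseq X n.+1 [set s | ((count_mem v (behead s))%:R -
    (count_mem u (behead s))%:R < delta / 2 * n%:R)%R]).
- exact: measurable_rejection.
move=> w /= dev; exists n.+1; rewrite lee_fin.
apply: le_trans (W_ge _); rewrite ler_expR.
rewrite size_behead size_mkseq/= /t.
nra.
Qed.

End Power.

Lemma not_unimodal_at (R : realType) (Q : probability int R) (theta : int) :
  ~ unimodal_at theta Q -> exists m : nat,
    mass Q (theta + m%:Z) < mass Q (theta + m.+1%:Z) \/
    mass Q (theta - m%:Z) < mass Q (theta - m.+1%:Z).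
Proof.
move=> notQ; apply: contrapT => noex; apply: notQ; split=> n ntheta.
  rewrite leNgt; apply/negP => lt_n; apply: noex.
  exists `|theta - n|%N; right.
  have -> : theta - `|theta - n|%N%:Z = n by lia.
  by have -> : theta - `|theta - n|.+1%:Z = n - 1 by lia.
rewrite leNgt; apply/negP => lt_n; apply: noex.
exists `|n - theta|%N; left.
have -> : theta + `|n - theta|%N%:Z = n by lia.
by have -> : theta + `|n - theta|.+1%:Z = n + 1 by lia.
Qed.

Lemma expR_dominates (R : realType) (b K e : R) : 0 < b -> 0 <= K -> 0 < e ->
  exists n0 : nat, forall n, (n0 < n)%N ->
    K * (n%:R + 1) ^+ 2 <= expR (b * n%:R) /\ expR (- (b * n%:R)) <= e.
Proof.
move=> b0 K0 e0.
(* Here 108 is [4 * 27], from [(n + 1) ^+ 2 <= 4 * n ^+ 2] and [expR (b * n) >= (b * n / 3) ^+ 3].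
   The second summand gives [b * n >= e^-1]. *)
exists (Num.truncn (108 * K / b ^+ 3 + (b * e)^-1)) => n n0n.
have Kb0 : 0 <= 108 * K / b ^+ 3 by rewrite divr_ge0 ?mulr_ge0 ?exprn_ge0// ltW.
have be0 : 0 < (b * e)^-1 by rewrite invr_gt0 mulr_gt0.
have nle : 108 * K / b ^+ 3 + (b * e)^-1 <= n%:R.
  by apply: ltW; apply: lt_le_trans (truncnS_gt _) _; rewrite ler_nat.
have n1 : 1 <= n%:R :> R by rewrite ler1n (leq_ltn_trans _ n0n).
split.
  have Kn : 108 * K <= n%:R * b ^+ 3.
    by rewrite -ler_pdivrMr ?exprn_gt0//; lra.
  have : (b * n%:R / 3) ^+ 3 <= expR (b * n%:R).
    have -> : expR (b * n%:R) = expR (b * n%:R / 3) ^+ 3.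
      by rewrite -expRM_natl; congr expR; field.
    rewrite lerXn2r ?nnegrE ?expR_ge0//.
      by rewrite divr_ge0// mulr_ge0// ltW.
    by apply: le_trans (expR_ge1Dx _); rewrite lerDr.
  apply: le_trans.
  have -> : (b * n%:R / 3) ^+ 3 = (n%:R * b ^+ 3) * n%:R ^+ 2 / 27 by field.
  rewrite ler_pdivlMr//.
  apply: (@le_trans _ _ ((108 * K) * n%:R ^+ 2)); last first.
    by rewrite ler_wpM2r// sqr_ge0.
  have : (n%:R + 1) ^+ 2 <= 4 * n%:R ^+ 2 :> R by nra.
  nra.
have ebn : (b * e)^-1 <= n%:R by lra.
rewrite expRN -[leRHS]invrK lef_pV2 ?posrE ?expR_gt0 ?invr_gt0//.
apply: (@le_trans _ _ (b * n%:R)).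
  by move: ebn; rewrite invfM mulrC ler_pdivrMr// mulrC.
by apply: le_trans (expR_ge1Dx _); rewrite lerDr.
Qed.

Section PowerOne.
Context d (Omega : measurableType d) (R : realType) (P : probability Omega R).
Variables (X : nat -> {RV P >-> int}) (Q : probability int R).
Hypothesis iidXQ : iid X Q.

Let low (c : R) theta n :=
  [set w | (J R (behead (mkseq (X ^~ w) n.+1)) theta < c%:E)%E].

Let measurable_low c theta n : measurable (low c theta n).
Proof.
exact: (measurable_mkseq X n.+1 [set s | (J R (behead s) theta < c%:E)%E]).
Qed.

Lemma probability_J_lt (theta : int) (c e : R) : ~ unimodal_at theta Q ->
  0 <= c -> 0 < e -> exists n0 : nat, forall n, (n0 < n)%N ->
  (P (low c theta n) <= e%:E)%E.
Proof.
move=> notQ c0 e0.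
(* The two sides of [theta] are treated alike: [g] recentres the data, sending [u] to [m] and the
   likelier [v] to [m + 1]. *)
have [m [g [u [v [uv [gu [gv Jg]]]]]]] : exists m : nat, exists g : int -> int,
    exists u, exists v, mass Q u < mass Q v /\
    (forall x, (g x == m%:Z) = (x == u)) /\
    (forall x, (g x == m.+1%:Z) = (x == v)) /\
    (forall y, (2 ^- m.+2 * J_factor R m (map g y))%:E <= J R y theta)%E.
  have [m [lt_m|lt_m]] := not_unimodal_at notQ; exists m.
    exists (fun x => x - theta), (theta + m%:Z), (theta + m.+1%:Z).
    split=> //; split; last split; last by move=> y; exact: (J_ge _ m y theta).1.
    - by move=> x; apply/eqP/eqP; lia.
    - by move=> x; apply/eqP/eqP; lia.
  exists (fun x => theta - x), (theta - m%:Z), (theta - m.+1%:Z).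
  split=> //; split; last split; last by move=> y; exact: (J_ge _ m y theta).2.
  - by move=> x; apply/eqP/eqP; lia.
  - by move=> x; apply/eqP/eqP; lia.
pose delta := mass Q v - mass Q u.
have delta0 : 0 < delta by rewrite subr_gt0.
have vE : mass Q v = mass Q u + delta by rewrite addrC subrK.
have b0 : 0 < delta ^+ 2 / 16 by rewrite divr_gt0// exprn_gt0.
(* The factor [2 ^+ m.+2] undoes the weight of the [m]-th term in [J]. *)
have K0 : 0 <= c * 2 ^+ m.+2 by rewrite mulr_ge0// exprn_ge0.
have [n0 n0P] := expR_dominates b0 K0 e0.
exists n0 => n n0n; have [Kn en] := n0P _ n0n.
have nR : 1 <= n%:R :> R by rewrite ler1n (leq_ltn_trans _ n0n).
apply: (@le_trans _ _ (expR (- (delta ^+ 2 / 16 * n%:R)))%:E); last by rewrite lee_fin.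
apply: le_trans _ (count_deviation iidXQ n delta0 vE).
apply: le_measure; rewrite ?inE; first exact: measurable_low.
  exact: (measurable_mkseq X n.+1 [set s | ((count_mem v (behead s))%:R -
    (count_mem u (behead s))%:R < delta / 2 * n%:R)%R]).
suff dev s : size s = n -> (J R s theta < c%:E)%E ->
    (count_mem v s)%:R - (count_mem u s)%:R < delta / 2 * n%:R.
  by move=> w; apply: dev; rewrite size_behead size_mkseq.
move=> sn; apply: contraTT; rewrite -!leNgt => Sge.
apply: le_trans (Jg s); rewrite lee_fin.
have := @J_factor_ge R m (map g s); rewrite /= !count_map.
rewrite (eq_count (a1 := preim g (pred1 m%:Z)) gu).
rewrite (eq_count (a1 := preim g (pred1 m.+1%:Z)) gv).
have pqn : (count_mem u s)%:R + (count_mem v s)%:R <= n%:R :> R.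
  rewrite -natrD ler_nat -sn -count_predUI.
  rewrite (eq_count (a1 := predI _ _) (a2 := pred0)) ?count_pred0 ?addn0 ?count_size//.
  move=> x /=; apply/negP => /andP[/eqP -> /eqP uv'].
  by move: uv; rewrite uv' ltxx.
move: pqn Sge; set p : R := (count_mem u s)%:R; set q : R := (count_mem v s)%:R.
move=> pqn Sge; set a := Num.max _ _; set J' := J_factor _ _ _ => HJ.
have p0 : 0 <= p by []. have q0 : 0 <= q by [].
have an : delta / 2 * n%:R <= a by rewrite le_max Sge.
have dn0 : 0 < delta / 2 * n%:R by rewrite mulr_gt0//; lra.
have pq0 : 0 < p + q by lra.
have J0 : 0 < J' by exact: J_factor_gt0.
(* As [a >= delta / 2 * n] and [p + q <= n], the exponent [a ^+ 2 / (4 * (p + q))] is at least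
   [delta ^+ 2 / 16 * n], the rate of [count_deviation]. *)
have : expR (delta ^+ 2 / 16 * n%:R) <= (n%:R + 1) ^+ 2 * J'.
  apply: (@le_trans _ _ ((p + q + 1) ^+ 2 * J')); last first.
    by rewrite ler_pM2r// lerXn2r ?nnegrE ?lerD2r// addr_ge0// ltW.
  apply: le_trans HJ; rewrite ler_expR ler_pdivlMr ?mulr_gt0//.
  apply: (@le_trans _ _ ((delta / 2 * n%:R) ^+ 2)); last first.
    by rewrite lerXn2r// nnegrE ltW// (lt_le_trans dn0).
  have -> : (delta / 2 * n%:R) ^+ 2 = delta ^+ 2 / 16 * n%:R * (4 * n%:R) by field.
  by rewrite ler_wpM2l ?ler_pM2l// mulr_ge0// ltW.
move=> /(le_trans Kn); rewrite [leRHS]mulrC ler_pM2r; last first.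
  by rewrite exprn_gt0//; lra.
by rewrite mulrC ler_pdivlMl ?exprn_gt0// mulrC.
Qed.

Lemma probability_bigsetU_low (s : seq int) (c e : R) :
  (forall theta, ~ unimodal_at theta Q) -> 0 <= c -> 0 < e ->
  exists n0 : nat, forall n, (n0 < n)%N ->
    (P (\big[setU/set0]_(theta <- s) low c theta n) <= e%:E)%E.
Proof.
move=> notQ c0; elim: s e => [|theta s IH] e e0.
  by exists 0%N => n _; rewrite big_nil measure0 lee_fin ltW.
have e20 : 0 < e / 2 by rewrite divr_gt0.
have [n1 n1P] := IH _ e20.
have [n2 n2P] := probability_J_lt (notQ theta) c0 e20.
exists (maxn n1 n2) => n; rewrite gtn_max => /andP[n1n n2n].
rewrite big_cons; apply: le_trans (measureU2 _ _ _) _ => //.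
  by apply: bigsetU_measurable => t _; exact: measurable_low.
have -> : e%:E = ((e / 2)%:E + (e / 2)%:E)%E by rewrite -EFinD; congr (_%:E); lra.
by apply: leeD; [exact: n2P|exact: n1P].
Qed.

(** Split by the countably many values [x] of [X 0]. On each piece the candidate set is fixed and
    finite, and non-rejection keeps [J] below [3 / alpha] at some candidate for every sample size,
    which has arbitrarily small probability. *)
Lemma rejection_not_unimodal (alpha : R) (phi : int) :
  0 < alpha < 1 -> phi != 0 -> (~` @unimodal R) Q ->
  P (rejection (unimodality_test alpha phi) X) = 1%E.
Proof.
move=> /andP[a0 a1] phi0 notQ.
set rej := rejection _ _.
have mrej : measurable rej by exact: measurable_rejection.
have {}notQ theta : ~ unimodal_at theta Q by move=> Qt; apply: notQ; exists theta.
have c0 : 0 <= 3 / alpha by rewrite divr_ge0// ltW.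
have mX x : measurable (X 0 @^-1` [set x] `\` rej).
  apply: measurableD => //.
  by rewrite -[X in measurable X]setTI; exact: measurable_funP.
have PX x : P (X 0 @^-1` [set x] `\` rej) = 0.
  apply/eqP; rewrite -measure_le0; apply/lee_addgt0Pr => e e0; rewrite add0e.
  have a3 : 0 < alpha / 3 by rewrite divr_gt0.
  (* Finiteness rests on [phi != 0]: [x] cannot equal both [phi] and [- phi], so at least one
     interval is bounded. *)
  have /finite_seqP[s sE] := @CI2_finite R x (alpha / 3) phi phi0.
  have [n0 /(_ n0.+1 (ltnSn _))] := probability_bigsetU_low s notQ c0 e0.
  apply: le_trans; apply: le_measure; rewrite ?inE//.
    by apply: bigsetU_measurable => t _; exact: measurable_low.
  move=> w [/= Xx notrej]; apply: contrapT => notlow; apply: notrej.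
  (* After the first observation is dropped, [n0.+1] remain, just above the threshold [n0]. *)
  exists n0.+2; split; first by rewrite size_mkseq.
  rewrite [head _ _]Xx sE; apply: le_ereal_inf_tmp => _ [theta ts <-].
  rewrite leNgt; apply/negP => lt_theta; apply: notlow.
  by rewrite -bigcup_seq; exists theta.
suff P0 : P (~` rej) = 0.
  have := probability_setC P mrej; rewrite P0 => /esym/eqP.
  by rewrite sube_eq ?fin_num_measure// add0e => /eqP.
pose F i := if pickle_inv i is Some x then X 0 @^-1` [set x] `\` rej else set0.
have PF i : P (F i) = 0 by rewrite /F; case: (pickle_inv i).
apply/eqP; rewrite -measure_le0.
apply: (@le_trans _ _ (\sum_(0 <= i <oo) P (F i))%E); last first.
  by rewrite eseries0// => i _ _; exact: PF.
apply: measure_sigma_subadditive; [|exact: measurableC|].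
  by move=> i; rewrite /F; case: (pickle_inv i).
move=> w notrej; exists (pickle (X 0 w)); first exact: I.
by rewrite /F pickleK_inv.
Qed.

End PowerOne.

Theorem theorem3p11 (R : realType) (alpha : R) (phi : int)
    (halpha : 0 < alpha < 1) (hphi : phi != 0) :
  type1_error_control (unimodality_test alpha phi) (@unimodal R) alpha /\
  power_one (unimodality_test alpha phi) (~` @unimodal R).
Proof.
split=> [Q [theta _ Qtheta]|Q notQ] d Omega P X iidXQ.
  exact: rejection_unimodal_le Qtheta.
exact: rejection_not_unimodal notQ.
Qed.
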